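(* Let $\{l_i\}_{i=0}^{2p-1}$ be a layering (of permutations of $\{1,\dots,2p\}$) and let $\Delta$ be the matrix $$\Delta = J - 2p\, I_{2p} + \frac{2}{2p-1} L ,$$ where $J$ is the $2p\times 2p$ matrix with $1$ in all its entries, $I_{2p}$ is the identity matrix and $L$ is the Laplacian of the graph associated to the layering. Then, if $\Delta$ is positive semi-definite, there exists a matrix $A$ of rank at most $p$ such that $$\Delta = A^{\intercal} A,$$ and the columns $\{\xi_i\}_{i=1}^{2p}$ of $A$ form a set of distance symmetric points in $t\,\mathbb{S}^{2p-1}$, where $t=\sqrt{\frac{2p-1}{2p}}$. Moreover, $p$ must be even.
   Context: Here $p$ is a positive integer, and $t\,\mathbb{S}^{2p-1}$ is the sphere of radius $t$ centered at the origin in $\mathbb{R}^{2p}$. Layering: a layering is a family $\{l_i\}_{i=0}^{N-1}$ of permutations of $\{1,\dots,N\}$ such that (1) $l_0(j)=j$ for all $j$; (2) $l_i(1)=i+1$ for all $i$; (3) for all $i\ne k$ and all $j$, $l_i(j)\neq l_k(j)$; (4) $l_i^{-1}=l_i$ for all $i$. Its distance function is $d_{ij}$ = the integer with $l_{d_{ij}}(i)=j$ (so $d_{ii}=0$ and $d_{ij}=d_{ji}$). The graph associated to a layering with $N=2p$ is the complete graph on vertices $v_1,\dots,v_{2p}$ with edge weights $w(\{v_i,v_j\})=d_{ij}$; its Laplacian $L$ (degree matrix minus weighted adjacency matrix) has off-diagonal entries $L_{ij}=-d_{ij}$ and diagonal entries $L_{ii}=\sum_{j\ne i}d_{ij}$.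 A set $\{\xi_1,\dots,\xi_N\}$ of points in Euclidean space is distance symmetric if there is a layering $\{l_i\}_{i=0}^{N-1}$ such that $|\xi_j-\xi_{l_i(j)}| = 2\sqrt{i}\,\frac{1}{\sqrt{N}}$ for all $j\in\{1,\dots,N\}$ and all $i\in\{0,\dots,N-1\}$.
   Formalization: Since Δ has unit diagonal, the columns of A have norm 1, not t; the distance symmetric points on the sphere of radius t are therefore the scaled columns tξ_i. That p is even is claimed only for p > 1, as it fails for p = 1, where Δ is positive semi-definite. *)

(* Defs.v *)
From mathcomp Require Import all_boot all_order all_algebra all_fingroup.
From mathcomp Require Import reals.

Set Implicit Arguments.
Unset Strict Implicit.
Unset Printing Implicit Defensive.

Import Order.TTheory GRing.Theory Num.Theory.
Local Open Scope ring_scope.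

(* The set {1, ..., N} is represented by 'I_N with values shifted down by one,
   so that l_i(1) = i + 1 becomes l_i(0) = i. *)
Record layering (N : nat) (l : 'I_N -> {perm 'I_N}) : Prop := Layering {
  layering_id : forall i j : 'I_N, i = 0%N :> nat -> l i j = j;
  layering_first : forall i j : 'I_N, j = 0%N :> nat -> l i j = i;
  layering_disjoint : forall i k j : 'I_N, i != k -> l i j != l k j;
  layering_inv : forall i : 'I_N, (l i)^-1%g = l i
}.

(* The default value i of [odflt] is never used for a layering: see
   [layer_distP] and [layer_dist_uniq]. *)
Definition layer_dist (N : nat) (l : 'I_N -> {perm 'I_N}) (i j : 'I_N) : 'I_N :=
  odflt i [pick d | l d i == j].

Lemma layer_distP (N : nat) (l : 'I_N -> {perm 'I_N}) (i j : 'I_N) :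
  layering l -> l (layer_dist l i j) i = j.
Proof.
move=> hl; rewrite /layer_dist; case: pickP => [d /eqP //|no_d].
have inj_l : injective (fun d => l d i).
  by move=> d e eq_de; apply/eqP/contraT => /(layering_disjoint hl i) /eqP.
have := no_d (invF inj_l j).
by rewrite (f_invF inj_l j) eqxx.
Qed.

Lemma layer_dist_uniq (N : nat) (l : 'I_N -> {perm 'I_N}) (i j d : 'I_N) :
  layering l -> l d i = j -> layer_dist l i j = d.
Proof.
move=> hl <-; apply/eqP/contraT => /(layering_disjoint hl i) /eqP; case.
exact: layer_distP.
Qed.

Section Matrices.
Variable R : rcfType.

Definition layer_adjacency (N : nat) (l : 'I_N -> {perm 'I_N}) : 'M[R]_N :=
  \matrix_(i, j) (if i == j then 0 else (layer_dist l i j)%:R).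

Definition laplacian (N : nat) (W : 'M[R]_N) : 'M[R]_N :=
  diag_mx (\row_i \sum_j W i j) - W.

Definition layer_laplacian (N : nat) (l : 'I_N -> {perm 'I_N}) : 'M[R]_N :=
  laplacian (layer_adjacency l).

Definition Delta (p : nat) (l : 'I_(2 * p) -> {perm 'I_(2 * p)}) :
    'M[R]_(2 * p) :=
  const_mx 1 - (2 * p)%:R%:M + (2 / ((2 * p)%:R - 1)) *: layer_laplacian l.

Definition pos_semidefinite (n : nat) (M : 'M[R]_n) : Prop :=
  M^T = M /\ forall x : 'cV[R]_n, 0 <= (x^T *m M *m x) 0 0.

(* The norm `|x| of MathComp-Analysis on matrices is the sup norm. *)
Definition euclidean_norm (n : nat) (x : 'cV[R]_n) : R :=
  Num.sqrt (\sum_i x i 0 ^+ 2).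

Definition on_sphere (n : nat) (t : R) (x : 'cV[R]_n) : Prop :=
  euclidean_norm x = t.

Definition distance_symmetric (n N : nat) (xi : 'I_N -> 'cV[R]_n) : Prop :=
  exists2 l : 'I_N -> {perm 'I_N}, layering l &
    forall j i : 'I_N,
      euclidean_norm (xi j - xi (l i j)) =
        2 * Num.sqrt i%:R * (1 / Num.sqrt N%:R).

(* The diagonal of [Delta l] is 1, so whenever Delta l = A^T *m A the columns
   of A are unit vectors; the points on the sphere of this radius are obtained
   from them by scaling. *)
Definition layer_radius (p : nat) : R :=
  Num.sqrt (((2 * p)%:R - 1) / (2 * p)%:R).

End Matrices.

Arguments layer_adjacency R {N} l.
Arguments layer_laplacian R {N} l.
Arguments Delta R {p} l.
Arguments layer_radius R p : clear implicits.

(* Main.v *)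
Require Import Defs.
From mathcomp Require Import all_boot all_order all_algebra all_fingroup.
From mathcomp Require Import reals ring lra zify.

(** In each row of the distance matrix every value 0, ..., 2p - 1 occurs once,
    so all vertices have weighted degree p (2p - 1).  Hence every entry of Delta
    is the affine function 1 - 2 d_ij / (2p - 1) of the distance ([DeltaE]): it
    is 1 on the diagonal and -1 at the largest distance.  A positive
    semi-definite Delta is a Gram matrix A^T A ([psd_gram]), so the columns of A
    are unit vectors with squared distances 4 d_ij / (2p - 1), and scaling by
    sqrt ((2p - 1) / 2p) turns these into 4 d_ij / 2p.

    The rest follows from the last layer sigma, of index 2p - 1.  The columns i
    and sigma i are unit vectors of scalar product -1, hence opposite
    ([antipodal_columns]).  So the 2p columns form p antipodal pairs, which
    bounds the rank by p ([gram_rank]).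

    Negating both vectors keeps scalar products, and Delta determines distances,
    so sigma is an isometry of the distance and commutes with every layer
    ([antipode_layer]).  If p > 1, layer 1 therefore acts on the p antipodal
    pairs as an involution, and it fixes no pair because it differs everywhere
    from layers 0 and 2p - 1.  A set with a fixed-point-free involution has
    even cardinality, so p is even ([even_half_size]). *)

Set Implicit Arguments.
Unset Strict Implicit.
Unset Printing Implicit Defensive.

Import Order.TTheory GRing.Theory Num.Theory.
Local Open Scope ring_scope.

(** * Gram factorization of positive semi-definite matrices *)

Section Gram.
Variable R : rcfType.

Lemma quadratic_form_block n (a s : R) (b : 'rV[R]_n) (C : 'M[R]_n)
    (y : 'cV[R]_n) :
  ((col_mx s%:M y)^T *m block_mx a%:M b b^T C *m col_mx s%:M y) 0 0 =
  s ^+ 2 * a + 2 * s * (b *m y) 0 0 + (y^T *m C *m y) 0 0.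
Proof.
rewrite tr_col_mx tr_scalar_mx mul_row_block mul_row_col.
rewrite !mulmxDl !mul_scalar_mx !mul_mx_scalar -!scalemxAl -trmx_mul !mxE.
by rewrite eqxx mulr1n; ring.
Qed.

(** With a zero in the corner the quadratic form is affine in the first
    coordinate, so it can only be bounded below if its slope vanishes. *)
Lemma psd_row_eq0 n (b : 'rV[R]_n) (C : 'M[R]_n) :
  pos_semidefinite (block_mx (0%:M : 'M_1) b b^T C) -> b = 0.
Proof.
move=> [_ psd]; apply/rowP => j; rewrite mxE; apply/eqP/contraT => bj0.
pose y : 'cV[R]_n := delta_mx j 0.
pose c := (y^T *m C *m y) 0 0.
have byE : (b *m y) 0 0 = b 0 j.
  by rewrite /y -colE mxE.
(* This first coordinate gives the form the value -1. *)
have := psd (col_mx (- (c + 1) / (2 * b 0 j))%:M y).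
rewrite quadratic_form_block byE -/c.
suff -> : (- (c + 1) / (2 * b 0 j)) ^+ 2 * 0
    + 2 * (- (c + 1) / (2 * b 0 j)) * b 0 j + c = -1 by rewrite ler0N1.
by field.
Qed.

(** Cholesky factorization, by induction on the size: one step splits off the
    first row and column and recurses on the Schur complement C - a^-1 b^T b.
    A zero pivot a needs no other formula: then b = 0 by [psd_row_eq0], and
    the convention 0^-1 = 0 makes the Schur complement equal to C. *)
Lemma psd_gram n (M : 'M[R]_n) :
  pos_semidefinite M -> exists A : 'M[R]_n, M = A^T *m A.
Proof.
elim: n M => [|n IHn] M; first by exists 0; apply/matrixP => -[].
rewrite -[n.+1]/(1 + n)%N in M *.
set a := ulsubmx M 0 0; set b := ursubmx M; set C := drsubmx M => psdM.
have symM := psdM.1.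
have defM : M = block_mx a%:M b b^T C.
  by rewrite -{1}[M]submxK {1}[ulsubmx M]mx11_scalar trmx_ursub symM.
have symC : C^T = C by rewrite trmx_drsub symM.
rewrite defM in psdM *; move: (a) (b) (C) symC psdM => {}a {}b {}C symC psdM {M defM symM}.
have psd_form s (y : 'cV_n) :
    0 <= s ^+ 2 * a + 2 * s * (b *m y) 0 0 + (y^T *m C *m y) 0 0.
  by rewrite -quadratic_form_block psdM.2.
have a_ge0 : 0 <= a.
  by have := psd_form 1 0; rewrite !mulmx0 !mxE expr1n mul1r mulr0 !addr0.
have b0 : a = 0 -> b = 0.
  by move=> a0; apply: (@psd_row_eq0 _ b C); rewrite -a0.
have [|A' defS] := IHn (C - a^-1 *: (b^T *m b)).
  split; first by rewrite linearB linearZ /= trmx_mul trmxK symC.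
  move=> y; rewrite mulmxBr mulmxBl -scalemxAr -scalemxAl mulmxA -[_ *m b *m y]mulmxA.
  have byT : (b *m y)^T = b *m y by rewrite [b *m y]mx11_scalar tr_scalar_mx.
  have -> : (y^T *m C *m y - a^-1 *: (y^T *m b^T *m (b *m y))) 0 0 =
      (y^T *m C *m y) 0 0 - a^-1 * (b *m y) 0 0 ^+ 2.
    rewrite -trmx_mul byT; move: (b *m y) (y^T *m C *m y) => v u.
    by rewrite !mxE big_ord1 expr2.
  (* For a > 0 this first coordinate minimizes the form at the given y. *)
  have := psd_form (- (a^-1 * (b *m y) 0 0)) y.
  have [a0|a0] := eqVneq a 0.
    by rewrite (b0 a0) !mul0mx !mxE; lra.
  congr (_ <= _); by field.
pose s := Num.sqrt a; have ss : s * s = a by rewrite -expr2 sqr_sqrtr.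
exists (block_mx s%:M (s^-1 *: b) 0 A').
have bT : (s^-1 *: b)^T = s^-1 *: b^T by rewrite linearZ.
have Eb : (s / s) *: b = b.
  have [a0|a0] := eqVneq a 0; first by rewrite b0 // scaler0.
  by rewrite divff ?scale1r //; apply: contra_neq a0 => s0; rewrite -ss s0 mul0r.
rewrite tr_block_mx mulmx_block !tr_scalar_mx trmx0 !mul0mx !mulmx0 !addr0 -defS bT.
rewrite -scalar_mxM ss mul_scalar_mx mul_mx_scalar !scalerA -scalemxAl -scalemxAr.
rewrite scalerA -invfM ss addrC subrK.
by congr block_mx; rewrite // -[in LHS]Eb linearZ.
Qed.

End Gram.

(** * Fixed-point-free involutions *)

(** The order on 'I_n selects one point of each pair {x, f x}, so the selected
    set and its image under f partition A. *)
Lemma card_fixfree_involution n (A : {set 'I_n}) (f : 'I_n -> 'I_n) :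
    {in A, forall x, f x \in A} -> {in A, involutive f} ->
    {in A, forall x, f x != x} ->
  #|A| = (2 * #|[set x in A | (x < f x)%N]|)%N.
Proof.
move=> fA fK f_neq; set B := [set x in A | _].
have sBA : B \subset A by apply/subsetP => x /setIdP[].
have fB : A :\: B = f @: B.
  apply/setP => x; rewrite !inE; apply/andP/imsetP => [[xB xA]|[y /setIdP[yA ltyf] ->]].
    exists (f x); last by rewrite fK.
    have := f_neq x xA; rewrite inE fA // fK // -val_eqE /=.
    by move: xB; rewrite xA /= -leqNgt; lia.
  by rewrite fA // fK // -leqNgt ltnW.
have injf : {in B &, injective f}.
  move=> x y /setIdP[xA _] /setIdP[yA _] eqf.
  by rewrite -[x]fK // eqf fK.
by rewrite -(cardsID B A) (setIidPr sBA) fB card_in_imset // addnn mul2n.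
Qed.

(** The set counts the pairs {x, f x}, represented by their smaller points.
    Since g commutes with f it permutes these pairs, and the last hypotheses say
    that it fixes none; so the pairs are matched in twos. *)
Lemma even_card_commuting_involutions n (f g : 'I_n -> 'I_n) :
    involutive f -> involutive g -> (forall x, f (g x) = g (f x)) ->
    (forall x, f x != x) -> (forall x, g x != x) -> (forall x, g x != f x) ->
  ~~ odd #|[set x : 'I_n | (x < f x)%N]|.
Proof.
move=> fK gK fgC f_neq g_neq gf_neq; set S := [set x | _].
have fS x : x \notin S -> f x \in S.
  by have := f_neq x; rewrite !inE fK -val_eqE /=; lia.
have fSN x : x \in S -> f x \notin S.
  by rewrite !inE fK -leqNgt => /ltnW.
(* The action of g on pairs, transported to their representatives. *)
pose h x := if g x \in S then g x else f (g x).
rewrite (@card_fixfree_involution _ S h) ?oddM // => x xS; rewrite /h.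
- by case: ifPn => // /fS.
- have [gxS|gxS] := boolP (g x \in S); first by rewrite gK xS.
  by rewrite -fgC gK (negbTE (fSN _ xS)) fK.
- case: ifPn => // _; apply: contraNneq (gf_neq x) => eqx.
  by rewrite -{2}eqx fK.
Qed.

(** * Distances of a layering *)

Section Layering.
Variables (N : nat) (l : 'I_N -> {perm 'I_N}).
Hypothesis hl : layering l.

Lemma layeringK d : involutive (l d).
Proof. by move=> j; rewrite -{1}(layering_inv hl d) permK. Qed.

Lemma layering_neq (d j : 'I_N) : d != 0%N :> nat -> l d j != j.
Proof.
move=> d0; have N0 : (0 < N)%N by apply: leq_ltn_trans (ltn_ord d).
rewrite -{2}(layering_id hl (i := Ordinal N0) j) //.
by apply: (layering_disjoint hl); apply: contraNneq d0 => ->.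
Qed.

Lemma layer_dist_layer d j : layer_dist l j (l d j) = d.
Proof. exact: layer_dist_uniq. Qed.

Lemma layer_distxx j : layer_dist l j j = 0%N :> nat.
Proof.
have N0 : (0 < N)%N by apply: leq_ltn_trans (ltn_ord j).
by rewrite (layer_dist_uniq (d := Ordinal N0) hl) //; apply: (layering_id hl).
Qed.

Lemma layer_distC i j : layer_dist l i j = layer_dist l j i.
Proof. by apply: layer_dist_uniq => //; rewrite -{2}(layer_distP j i hl) layeringK. Qed.

Variable R : rcfType.

Lemma layer_adjacencyE i j : layer_adjacency R l i j = (layer_dist l i j)%:R.
Proof. by rewrite mxE; case: eqVneq => // ->; rewrite layer_distxx. Qed.

(** Row i of the distance matrix is a permutation of 0, ..., N - 1, because
    d |-> l d i is inverse to the distance from i. *)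
Lemma layer_degree i :
  2 * (\sum_j layer_adjacency R l i j) = N%:R * (N%:R - 1).
Proof.
have -> : \sum_j layer_adjacency R l i j = \sum_(d < N) d%:R.
  rewrite (reindex (fun d => l d i)) /=; last first.
    by exists (layer_dist l i) => [d|j] _; [rewrite layer_dist_layer | rewrite layer_distP].
  by apply: eq_bigr => d _; rewrite layer_adjacencyE layer_dist_layer.
elim: (N) => [|n IHn]; first by rewrite big_ord0 mulr0 mul0r.
by rewrite big_ord_recr /= mulrDr IHn -[n.+1%:R]natr1; ring.
Qed.

End Layering.

(** * The matrix Delta *)

Section DeltaTheory.
Variables (R : rcfType) (p : nat).
Hypothesis p_gt0 : (0 < p)%N.
Variable l : 'I_(2 * p) -> {perm 'I_(2 * p)}.
Hypothesis hl : layering l.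

Let N_gt1 : 1 < (2 * p)%:R :> R.
Proof. by rewrite ltr1n; lia. Qed.

Lemma DeltaE i j :
  Delta R l i j = 1 - 2 * (layer_dist l i j)%:R / ((2 * p)%:R - 1).
Proof.
rewrite /Delta /layer_laplacian.
have := layer_degree hl R i; have := layer_adjacencyE hl R i j.
move: (layer_adjacency R l) => W Wij deg; rewrite !mxE Wij.
have -> : \sum_k W i k = (2 * p)%:R * ((2 * p)%:R - 1) / 2 by rewrite -deg; field.
clear deg; have := N_gt1; move: ((2 * p)%:R : R) => n n1.
have n1' : n - 1 != 0 by rewrite subr_eq0 gt_eqF.
have [->|ij] := eqVneq i j.
  by rewrite layer_distxx // !mulr1n; field.
by rewrite !mulr0n; field.
Qed.

Lemma Delta_diag i : Delta R l i i = 1.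
Proof. by rewrite DeltaE layer_distxx // mulr0 mul0r subr0. Qed.

Lemma Delta_dist_inj i j k h :
  Delta R l i j = Delta R l k h -> layer_dist l i j = layer_dist l k h.
Proof.
have n1' : ((2 * p)%:R - 1 : R) != 0 by rewrite subr_eq0 gt_eqF.
rewrite !DeltaE => /addrI /oppr_inj /(mulIf (invr_neq0 n1')).
by move=> /mulfI; rewrite pnatr_eq0 => /(_ isT) /eqP; rewrite eqr_nat => /eqP /val_inj.
Qed.

Section Antipode.
Variable A : 'M[R]_(2 * p).
Hypothesis gramA : Delta R l = A^T *m A.

Lemma gram_dot i j : \sum_k A k i * A k j = Delta R l i j.
Proof. by rewrite gramA mxE; apply: eq_bigr => k _; rewrite mxE. Qed.

Lemma gram_sqdist i j :
  \sum_k (A k i - A k j) ^+ 2 = 4 * (layer_dist l i j)%:R / ((2 * p)%:R - 1).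
Proof.
have -> : \sum_k (A k i - A k j) ^+ 2 =
    Delta R l i i + Delta R l j j - 2 * Delta R l i j.
  rewrite -!gram_dot mulr_sumr -big_split -sumrB /=.
  by apply: eq_bigr => k _; ring.
by rewrite !Delta_diag DeltaE; ring.
Qed.

Variable d : 'I_(2 * p).
Hypothesis d_max : d = (2 * p).-1 :> nat.

(** Equality case of Cauchy-Schwarz: unit vectors with scalar product -1 are
    opposite, since their sum has squared norm 1 + 1 - 2 = 0. *)
Lemma antipodal_columns i : col (l d i) A = - col i A.
Proof.
suff sum0 k : A k i + A k (l d i) = 0.
  by apply/colP => k; rewrite !mxE; apply/eqP; rewrite -addr_eq0 addrC sum0.
have : \sum_k (A k i + A k (l d i)) ^+ 2 = 0.
  have -> : \sum_k (A k i + A k (l d i)) ^+ 2 =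
      Delta R l i i + Delta R l (l d i) (l d i) + 2 * Delta R l i (l d i).
    rewrite -!gram_dot mulr_sumr -!big_split /=.
    by apply: eq_bigr => h _; ring.
  have n1' : ((2 * p)%:R - 1 : R) != 0 by rewrite subr_eq0 gt_eqF.
  rewrite !Delta_diag DeltaE layer_dist_layer // d_max -subn1 natrB; last lia.
  by move: ((2 * p)%:R : R) n1' => n n1'; field.
move/eqP; rewrite psumr_eq0 => [/allP/(_ k (mem_index_enum _))|h _]; last exact: sqr_ge0.
by rewrite sqrf_eq0 => /eqP.
Qed.

Lemma antipode_Delta i j : Delta R l (l d i) j = - Delta R l i j.
Proof.
rewrite -!gram_dot -sumrN; apply: eq_bigr => k _.
by have /colP/(_ k) := antipodal_columns i; rewrite !mxE => ->; rewrite mulNr.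
Qed.

(** Applying the antipode to both arguments of Delta changes the sign twice,
    hence preserves distances; and a layer is recovered from the distance, as
    l e i is the only point at distance e from i. *)
Lemma antipode_layer e i : l d (l e i) = l e (l d i).
Proof.
have dist_eq : layer_dist l (l d i) (l d (l e i)) = e.
  rewrite -(layer_dist_layer hl e i); apply: Delta_dist_inj.
  have DeltaC a b : Delta R l a b = Delta R l b a by rewrite !DeltaE layer_distC.
  by rewrite antipode_Delta DeltaC antipode_Delta DeltaC opprK layer_dist_layer.
by rewrite -{2}dist_eq layer_distP.
Qed.

Lemma card_antipode_pairs : #|[set x : 'I_(2 * p) | (x < l d x)%N]| = p.
Proof.
have d0 : d != 0%N :> nat by rewrite d_max; lia.
have : #|[set: 'I_(2 * p)]| = (2 * #|[set x in [set: 'I_(2 * p)] | (x < l d x)%N]|)%N.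
  apply: card_fixfree_involution => x _; [exact: in_setT | exact: layeringK | exact: layering_neq].
rewrite cardsT card_ord => /eqP; rewrite eqn_mul2l /= => /eqP defp.
by apply: etrans (esym defp); apply: eq_card => x; rewrite !inE.
Qed.

(** The columns of one representative of each antipodal pair span all columns.
    Transposing A turns this into an inclusion of row spaces. *)
Lemma gram_rank : (\rank A <= p)%N.
Proof.
rewrite -mxrank_tr; have := card_antipode_pairs; set S := [set x | _] => cardS.
apply: leq_trans (eq_leq cardS).
pose V := rowsub (enum_val : 'I_#|S| -> _) A^T.
have rowS i : i \in S -> (row i A^T <= V)%MS.
  move=> iS; have -> : row i A^T = row (enum_rank_in iS i) V.
    by rewrite row_rowsub enum_rankK_in.
  exact: row_sub.
apply: leq_trans (rank_leq_row V); apply/mxrankS/row_subP => i.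
have [/rowS//|iS] := boolP (i \in S).
rewrite -tr_col -[i](layeringK hl d) antipodal_columns linearN eqmx_opp /= tr_col.
have d0 : d != 0%N :> nat by rewrite d_max; lia.
apply: rowS; move: iS (layering_neq hl i d0); rewrite !inE layeringK // -val_eqE /=.
lia.
Qed.

Lemma even_half_size : (1 < p)%N -> ~~ odd p.
Proof.
move=> p1; have lt1 : (1 < 2 * p)%N by lia.
have d0 : d != 0%N :> nat by rewrite d_max; lia.
rewrite -[odd p](congr1 odd card_antipode_pairs).
apply: (@even_card_commuting_involutions _ _ (l (Ordinal lt1))); try exact: layeringK.
- by move=> x; rewrite antipode_layer.
- by move=> x; apply: layering_neq.
- by move=> x; apply: layering_neq.
- by move=> x; apply: (layering_disjoint hl); rewrite -val_eqE /= d_max; lia.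
Qed.

End Antipode.

Lemma gram_distance_symmetric (A : 'M[R]_(2 * p)) :
  Delta R l = A^T *m A ->
  distance_symmetric (fun i => layer_radius R p *: col i A).
Proof.
move=> gramA; exists l => // j i; rewrite /euclidean_norm -scalerBr.
have -> : \sum_k (layer_radius R p *: (col j A - col (l i j) A)) k 0 ^+ 2 =
    2 ^+ 2 * i%:R * (2 * p)%:R^-1.
  under eq_bigr => k _ do rewrite !mxE exprMn.
  rewrite -mulr_sumr gram_sqdist // layer_dist_layer // /layer_radius.
  have := N_gt1; move: ((2 * p)%:R : R) => n n1.
  rewrite sqr_sqrtr; last by apply: divr_ge0; lra.
  by field; rewrite subr_eq0 !gt_eqF //; lra.
by rewrite sqrtrM ?mulr_ge0 // sqrtrM ?sqr_ge0 // sqrtr_sqr ger0_norm // sqrtrV ?mul1r.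
Qed.

Lemma gram_on_sphere (A : 'M[R]_(2 * p)) i :
  Delta R l = A^T *m A ->
  on_sphere (layer_radius R p) (layer_radius R p *: col i A).
Proof.
move=> gramA; rewrite /on_sphere /euclidean_norm.
under eq_bigr => k _ do rewrite !mxE exprMn [_ ^+ 2 in X in _ * X]expr2.
by rewrite -mulr_sumr (gram_dot gramA) Delta_diag mulr1 sqrtr_sqr ger0_norm ?sqrtr_ge0.
Qed.

End DeltaTheory.

Theorem theorem5p6 (R : realType) (p : nat) (hp : (0 < p)%N)
    (l : 'I_(2 * p) -> {perm 'I_(2 * p)}) (hl : layering l)
    (hD : pos_semidefinite (Delta R l)) :
  (exists A : 'M[R]_(2 * p),
    [/\ (\rank A <= p)%N,
        Delta R l = A^T *m A,
        distance_symmetric (fun i => layer_radius R p *: col i A) &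
        forall i, on_sphere (layer_radius R p) (layer_radius R p *: col i A)])
  /\ ((1 < p)%N -> ~~ odd p).
Proof.
have [A gramA] := psd_gram hD.
have ltd : ((2 * p).-1 < 2 * p)%N by lia.
split; last exact: (even_half_size hp hl gramA (d := Ordinal ltd)).
exists A; split=> //.
- exact: (gram_rank hp hl gramA (d := Ordinal ltd)).
- exact: (gram_distance_symmetric hp hl gramA).
- by move=> i; exact: (gram_on_sphere hp hl i gramA).
Qed.
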